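(* Let $(X,T)$ be a topological dynamical system and let $\mathcal{E}\colon\mathcal{M}(X)\to\mathbb{R}$ be an energy. Then $$P(T,\mathcal{E})=\sup_{\mathcal{U}\in\mathcal{C}_X^o}P(T,\mathcal{E};\mathcal{U})\qquad\text{and}\qquad \underline{P}(T,\mathcal{E})=\sup_{\mathcal{U}\in\mathcal{C}_X^o}\underline{P}(T,\mathcal{E};\mathcal{U}).$$
   Context: A topological dynamical system (TDS) is a pair $(X,T)$ with $X$ a compact metric space (metric $d$) and $T:X\to X$ a continuous surjection. $\mathcal{M}(X)$ is the set of Borel probability measures on $X$ with the weak-star topology. An energy is a weak-star continuous function $\mathcal{E}\colon\mathcal{M}(X)\to\mathbb{R}$. For $x\in X$, $n\ge1$, $\triangle_x^n=\frac1n\sum_{i=0}^{n-1}\delta_{T^ix}$. A cover of $X$ is a finite collection of Borel subsets with union $X$; $\mathcal{C}_X$ and $\mathcal{C}_X^o$ denote the sets of covers and of open covers (covers consisting of open sets). $\mathcal{V}\succeq\mathcal{W}$ means each element of $\mathcal{V}$ is contained in some element of $\mathcal{W}$. $\mathcal{U}\vee\mathcal{V}=\{U\cap V: U\in\mathcal{U},V\in\mathcal{V}\}$ and $\mathcal{U}_0^{n-1}=\bigvee_{i=0}^{n-1}T^{-i}\mathcal{U}$. Nonlinear local pressures: for $\mathcal{U}\in\mathcal{C}_X^o$, $$p_n(T,\mathcal{E};\mathcal{U})=\inf\Big\{\sum_{V\in\mathcal{V}}\sup_{x\in V}e^{n\mathcal{E}(\triangle_x^n)}:\mathcal{V}\in\mathcal{C}_X,\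 \mathcal{V}\succeq\mathcal{U}_0^{n-1}\Big\},$$ $P(T,\mathcal{E};\mathcal{U})=\limsup_{n\to\infty}\frac1n\log p_n(T,\mathcal{E};\mathcal{U})$ and $\underline{P}(T,\mathcal{E};\mathcal{U})=\liminf_{n\to\infty}\frac1n\log p_n(T,\mathcal{E};\mathcal{U})$. Nonlinear topological pressures: $B_n(x,\varepsilon)=\{y\in X:d(T^ix,T^iy)<\varepsilon,\ 0\le i\le n-1\}$; a set $E\subset X$ is $(n,\varepsilon)$-separated if $y\notin B_n(x,\varepsilon)$ for all distinct $x,y\in E$. Let $$P_n(T,\mathcal{E},\varepsilon)=\sup\Big\{\sum_{x\in E}e^{n\mathcal{E}(\triangle_x^n)}:E\text{ is an }(n,\varepsilon)\text{-separated set of }X\Big\},$$ $P(T,\mathcal{E})=\lim_{\varepsilon\to0}\limsup_{n\to\infty}\frac1n\log P_n(T,\mathcal{E},\varepsilon)$ and $\underline{P}(T,\mathcal{E})=\lim_{\varepsilon\to0}\liminf_{n\to\infty}\frac1n\log P_n(T,\mathcal{E},\varepsilon)$. *)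

(* Defs.v *)
From HB Require Import structures.
From mathcomp Require Import all_boot all_order all_algebra.
From mathcomp Require Import all_classical all_reals all_analysis.

Set Implicit Arguments.
Unset Strict Implicit.
Unset Printing Implicit Defensive.

Import Order.TTheory GRing.Theory Num.Theory.
Import numFieldNormedType.Exports.

Local Open Scope classical_set_scope.
Local Open Scope ring_scope.

(* Metric spaces with a distinguished point. The point plays no mathematical
   role: measurable types are pointed in the library, so that Borel measures
   only make sense here on nonempty spaces with a chosen point. *)
#[short(type="pmetricType")]
HB.structure Definition PointedMetric (K : numDomainType) :=
  {M of Pointed M & Metric K M}.

Notation borelType X := (g_sigma_algebraType (@open X)).

Section borel_probabilities.
Context {R : realType} (X : pmetricType R).

Definition borel_probability := probability (borelType X) R.

Definition integral_pairing (mu : borel_probability) :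
    {ptws continuousType X R -> R} :=
  fun f => (\int[mu]_x f x)%R.

(* The weak-star topology is the coarsest one for which all the maps
   mu |-> \int f dmu with f continuous are continuous. *)
Definition weak_star := initial_topology integral_pairing.

Definition energy (E : borel_probability -> R) :=
  continuous (E : weak_star -> R).

End borel_probabilities.

Section nonlinear_pressure.
Context {R : realType} {X : pmetricType R}.
Variables (T : X -> X) (E : borel_probability X -> R).

(* For n > 0 this is the average of the Dirac masses at T^i x, i < n (see
   empiricalE); for n = 0 it is, by convention, the Dirac mass at x. *)
Definition empirical (n : nat) (x : X) : borel_probability X :=
  mnormalize (msum (fun i => @dirac _ (borelType X) (iter i T x) R) n)
             (@dirac _ (borelType X) x R).

Lemma empiricalE (n : nat) (x : X) (A : set X) : (0 < n)%N ->
  empirical n x A =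
  ((n%:R^-1)%:E * \sum_(i < n) @dirac _ (borelType X) (iter i T x) R A)%E.
Proof.
move=> n0; rewrite /empirical /= /mnormalize.
set m := (X in X [set: _]); have mT : m [set: _] = (n%:R)%:E.
  rewrite /m /= /msum (eq_bigr (fun=> 1%E)) => [|i _]; last exact: diracT.
  by rewrite sumEFin sumr_const card_ord.
by rewrite mT eqe pnatr_eq0 (gtn_eqF n0) /= muleC.
Qed.

Definition weight (n : nat) (x : X) : \bar R :=
  (expR (n%:R * E (empirical n x)))%:E.

Definition cover (U : set (set X)) :=
  [/\ finite_set U,
      forall V, U V -> measurable (V : set (borelType X)) &
      \bigcup_(V in U) V = [set: X]].

Definition open_cover (U : set (set X)) :=
  cover U /\ forall V, U V -> open V.

Definition finer (V W : set (set X)) :=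
  forall A, V A -> exists2 B, W B & A `<=` B.

Definition cover_join (U V : set (set X)) : set (set X) :=
  [set A `&` B | A in U & B in V].

Definition cover_preimage (i : nat) (U : set (set X)) : set (set X) :=
  [set iter i T @^-1` A | A in U].

Definition iterated_cover (U : set (set X)) (n : nat) : set (set X) :=
  \big[cover_join/[set [set: X]]]_(i < n) cover_preimage i U.

(* The supremum is taken in [0, +oo], so that it is 0 on the empty set. *)
Definition sup_weight (n : nat) (V : set X) : \bar R :=
  maxe 0%E (ereal_sup [set weight n x | x in V]).

Definition cover_sum (U : set (set X)) (n : nat) : \bar R :=
  ereal_inf [set (\sum_(V \in VV) sup_weight n V)%E | VV in
    [set VV | cover VV /\ finer VV (iterated_cover U n)]].

Definition local_pressure (U : set (set X)) : \bar R :=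
  limn_esup (fun n => (n%:R^-1)%:E * lne (cover_sum U n))%E.

Definition local_lower_pressure (U : set (set X)) : \bar R :=
  limn_einf (fun n => (n%:R^-1)%:E * lne (cover_sum U n))%E.

Definition bowen_ball (n : nat) (x : X) (e : R) : set X :=
  [set y | forall i, (i < n)%N -> mdist (iter i T x) (iter i T y) < e].

Definition separated (n : nat) (e : R) (S : set X) :=
  forall x y, S x -> S y -> x <> y -> ~ bowen_ball n x e y.

Definition separated_sum (e : R) (n : nat) : \bar R :=
  ereal_sup [set \esum_(x in S) weight n x | S in separated n e].

Definition pressure : \bar R :=
  lim (limn_esup (fun n => (n%:R^-1)%:E * lne (separated_sum e n))%E
         @[e --> 0^'+]).

Definition lower_pressure : \bar R :=
  lim (limn_einf (fun n => (n%:R^-1)%:E * lne (separated_sum e n))%E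
         @[e --> 0^'+]).

End nonlinear_pressure.

(* Main.v *)
(* The two families of quantities are compared at each fixed time [n].
   If the members of [U] have diameter less than [e], an element of a cover finer
   than the iterated cover contains at most one point of an (n, e)-separated set,
   so [separated_sum e n <= cover_sum U n].  If [e] is a Lebesgue number of [U],
   choose points greedily, each one almost maximizing the weight outside the
   Bowen balls of the previous ones; each ball minus the earlier ones is a Borel
   set on which the supremum of the weight is almost attained at its centre,
   whence [cover_sum U n <= separated_sum e n].  Choosing the points in this way
   replaces the uniform continuity of the energy, hence no compactness of the
   space of measures is involved. *)
Require Import Defs.
From mathcomp Require Import all_boot all_order all_algebra finmap.
From mathcomp Require Import all_classical all_reals all_analysis.
Import numFieldNormedType.Exports.

Local Open Scope classical_set_scope.
Local Open Scope ring_scope.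

Import Order.TTheory GRing.Theory Num.Theory.

(** * Open balls and Lebesgue numbers *)

Lemma metric_ball_open {R : realType} {X : metricType R} (x : X) (e : R) :
  open [set y | mdist x y < e].
Proof.
rewrite openE => y /= xy; apply/nbhs_ballP; exists (e - mdist x y) => /=.
  by rewrite subr_gt0.
move=> z; rewrite ballEmdist /= => yz.
by rewrite (le_lt_trans (metric_triangle _ y _))// -ltrBrDl.
Qed.

Lemma lebesgue_number {R : realType} {X : metricType R} (U : set (set X)) :
    compact [set: X] -> (forall V, U V -> open V) ->
    \bigcup_(V in U) V = [set: X] ->
  \forall e \near 0^'+,
    forall x, exists2 V, U V & [set y | mdist x y < e] `<=` V.
Proof.
move=> /compact_near_coveringP cX openU coverU.
suff : \forall e \near (0 : R)^'+, [set: X] `<=`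
    (fun x => exists2 V, U V & [set y | mdist x y < e] `<=` V).
  by apply: filterS => e He x; apply: He.
apply: cX => x _.
have [V UV Vx] : (\bigcup_(V in U) V) x by rewrite coverU.
have /nbhs_ballP[r /= r0 rV] : nbhs x V by apply: open_nbhs_nbhs; split; auto.
(* Half of [r] is spent on moving the centre from [x] to [y] and half on the radius [e], so the same
   [V] serves all nearby [y] and all small [e]. *)
have r20 : 0 < r / 2 by rewrite divr_gt0.
exists ([set y | mdist x y < r / 2], [set e | e < r / 2]); first split => /=.
- apply: open_nbhs_nbhs; split; first exact: metric_ball_open.
  by rewrite /= mdistxx.
- exact: nbhs_right_lt.
- move=> [y e] /= [xy er]; exists V => // z /= yz; apply: rV.
  rewrite ballEmdist /= (le_lt_trans (metric_triangle _ y _))// (splitr r).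
  by rewrite ltrD// (lt_trans yz).
Qed.

(** * Greedy choice of separated points *)

Section greedy.
Context d (T : measurableType d) (R : realType).
Variables (B : T -> set T) (w : T -> \bar R).
Hypothesis measB : forall x, measurable (B x).
Hypothesis symB : forall x y, B x y -> B y x.
Hypothesis w0 : forall x, (0 < w x)%E.

Let sw (V : set T) := maxe 0%E (ereal_sup [set w x | x in V]).

Let sw_ge0 V : (0 <= sw V)%E.
Proof. by rewrite le_max lexx. Qed.

(* Each step picks a point of the remaining set whose weight is at least [r]
   times the supremum there, and removes its ball [B x]; every step uses up one
   member of [s], which bounds the number of steps. *)
Lemma greedy_packing (r : R) (s : seq (set T)) (Y : set T) :
    0 < r < 1 -> measurable Y ->
    (forall C, C \in s -> forall x y, C x -> C y -> B x y) ->
    Y `<=` \bigcup_(C in [set` s]) C ->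
    (ereal_sup [set w x | x in Y] < +oo)%E ->
  exists S (VV : set (set T)),
    [/\ S `<=` Y, finite_set S &
        forall x y, S x -> S y -> x <> y -> ~ B x y] /\
    [/\ finite_set VV, Y = \bigcup_(V in VV) V,
        forall V, VV V -> measurable V,
        forall V, VV V -> exists x, V `<=` B x &
        (r%:E * \sum_(V \in VV) sw V <= \sum_(x \in S) w x)%E].
Proof.
move=> /andP[r0 r1]; move: {2}(size s) (leqnn (size s)) => n.
elim: n s Y => [|n IHn] s Y sn mY Bs Ys wY.
  have Y0 : Y = set0.
    rewrite -subset0 => x /Ys[C /=]; case: s sn {Bs Ys} => //.
  exists set0, set0; split; split => //.
  - by rewrite Y0 bigcup_set0.
  - by rewrite !fsbig_set0 mule0.
have [->|/set0P[z Yz]] := eqVneq Y set0.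
  exists set0, set0; split; split => //.
  - by rewrite bigcup_set0.
  - by rewrite !fsbig_set0 mule0.
set M := ereal_sup [set w x | x in Y] in wY.
have M0 : (0 < M)%E.
  by rewrite (lt_le_trans (w0 z))//; apply: ereal_sup_ubound; exists z.
(* [M] is finite and positive, so [r * M < M] strictly and some weight exceeds [r * M]. *)
have [x Yx Mx] : exists2 x, Y x & (r%:E * M < w x)%E.
  have /ereal_sup_gt[_ [x Yx <-] Mx] : (r%:E * M < M)%E.
    rewrite -(fineK (_ : M \is a fin_num)) ?fin_numElt ?wY ?(lt_trans _ M0)//.
    by rewrite -EFinM lte_fin gtr_pMl// fine_gt0// M0 wY.
  by exists x.
(* Any two points of [C] are related by [B], so [C] lies in [B x]; hence the list without [C] still
   covers what remains of [Y]. *)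
have [C sC Cx] := Ys _ Yx.
have Bx : B x x by apply: (Bs C).
have [|||||S [VV [[SY finS sepS] [finV YV mV VB rV]]]] :=
    IHn (rem C s) (Y `\` B x).
- by rewrite size_rem//; case: (s) sC sn.
- exact: measurableD.
- by move=> D /mem_rem; exact: Bs.
- move=> y [Yy nBy]; have [D /= sD Dy] := Ys _ Yy; exists D => //=.
  have DC : D != C.
    by apply/eqP => DC; apply: nBy; apply: (Bs C) => //; rewrite -DC.
  have := perm_to_rem sC => /perm_mem/(_ D).
  by rewrite sD inE (negbTE DC) => /esym.
- by apply: le_lt_trans wY; apply: ereal_sup_le; apply: image_subset => y [].
exists (x |` S), ((Y `&` B x) |` VV); split; split.
- by move=> y [->//|/SY[]].
- by rewrite finite_setU; split.
- move=> a b [->|Sa] [->|Sb] // ab; last exact: sepS.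
  + by have [] := SY _ Sb.
  + by move=> /symB; have [] := SY _ Sa.
- by rewrite finite_setU; split.
- by rewrite bigcup_setU1 -YV setUIDK.
- by move=> V [->|/mV//]; exact: measurableI.
- by move=> V [->|/VB//]; exists x => y [].
(* The supremum over the new piece is at most [M]; truncating it at 0 is harmless since [M] is
   positive. *)
have swx : (r%:E * sw (Y `&` B x) <= w x)%E.
  apply: le_trans (ltW Mx); rewrite lee_pmul2l ?lte_fin//.
  rewrite ge_max ltW//=; apply: ereal_sup_le.
  by apply: image_subset => y [].
(* The new piece is not yet in [VV]: it contains [x], while members of [VV] avoid [B x]. *)
rewrite fsbigU0//; last first.
  move=> V [-> /= VVV].
  have : (Y `\` B x) x by rewrite YV; exists (Y `&` B x).
  by case=> _; apply.
rewrite fsbigU0//; last by move=> y [-> /SY[]].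
rewrite !fsbig_set1 ge0_muleDr//; first exact: leeD.
exact: fsume_ge0.
Qed.

End greedy.

(** * Monotonicity of upper and lower limits *)

Lemma le_limn_esup {R : realType} (u v : nat -> \bar R) :
  (forall n, u n <= v n)%E -> (limn_esup u <= limn_esup v)%E.
Proof.
move=> uv; apply: le_ereal_inf_tmp => _ [V FV <-].
apply: ge_ereal_inf; exists (ereal_sup [set u n | n in V]); first by exists V.
apply: ge_ereal_sup => _ [n Vn <-]; apply: (le_trans (uv n)).
by apply: ereal_sup_ubound; exists n.
Qed.

Lemma le_limn_einf {R : realType} (u v : nat -> \bar R) :
  (forall n, u n <= v n)%E -> (limn_einf u <= limn_einf v)%E.
Proof.
by move=> uv; rewrite leeN2; apply: le_limn_esup => n /=; rewrite leeN2.
Qed.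

(** * Iterated covers, Bowen balls and covers of small mesh *)

Section pressure.
Context {R : realType} {X : pmetricType R}.
Variables (T : X -> X) (E : borel_probability X -> R).

Lemma big_cover_joinP (C : nat -> set (set X)) n A :
  (\big[cover_join (X := X)/[set [set: X]]]_(i < n) C i) A <->
  exists2 f : nat -> set X, forall i, (i < n)%N -> C i (f i) &
    A = \bigcap_(i < n) f i.
Proof.
elim: n C A => [|n IHn] C A.
  rewrite big_ord0; split => [->|[f _ ->]].
    by exists (fun=> setT) => //; rewrite bigcap_mkord big_ord0.
  by rewrite bigcap_mkord big_ord0.
rewrite big_ord_recl /=; split.
  move=> [V CV [A' /(IHn (fun i => C i.+1))[f Cf ->] <-]].
  exists (fun i => if i is j.+1 then f j else V); first by case=> [|i] // /Cf.
  by rewrite !bigcap_mkord big_ord_recl.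
move=> [f Cf ->]; exists (f 0); first exact: Cf.
exists (\bigcap_(i < n) f i.+1); last by rewrite !bigcap_mkord big_ord_recl.
by apply/(IHn (fun i => C i.+1)); exists (fun i => f i.+1) => // i ni; exact: Cf.
Qed.

(** This turns members of the iterated cover into itineraries: [f i] is the member of [U] visited at
    time [i]. The values of [f] from [n] on are arbitrary. *)
Lemma iterated_coverP (U : set (set X)) n A :
  iterated_cover T U n A <->
  exists2 f : nat -> set X, forall i, (i < n)%N -> U (f i) &
    A = \bigcap_(i < n) (iter i T @^-1` f i).
Proof.
split=> [/(big_cover_joinP (cover_preimage T ^~ U))[f Cf ->]|[f Uf ->]].
  have /choice[g Hg] i : exists V, (i < n)%N -> U V /\ iter i T @^-1` V = f i.
    have [/Cf[V UV fV]|_] := ltnP i n; last by exists set0.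
    by exists V.
  exists g => [i /Hg[]//|].
  by apply: eq_bigcapr => i /Hg[].
apply/(big_cover_joinP (cover_preimage T ^~ U)).
by exists (fun i => iter i T @^-1` f i) => // i ni; exists (f i) => //; exact: Uf.
Qed.

Lemma iterated_cover_finite (U : set (set X)) n :
  finite_set U -> finite_set (iterated_cover T U n).
Proof.
move=> finU; rewrite /iterated_cover; apply: (big_rec finite_set).
  exact: finite_set1.
by move=> i V _ finV; apply: finite_image2 => //; exact: finite_image.
Qed.

Lemma bigcup_iterated_cover (U : set (set X)) n :
  \bigcup_(V in U) V = [set: X] ->
  \bigcup_(V in iterated_cover T U n) V = [set: X].
Proof.
move=> coverU; rewrite -subTset => x _.
have /choice[f Hf] i : exists V, U V /\ V (iter i T x).
  have [V UV Vx] : (\bigcup_(V in U) V) (iter i T x) by rewrite coverU.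
  by exists V.
exists (\bigcap_(i < n) (iter i T @^-1` f i)).
  by apply/iterated_coverP; exists f => // i _; case: (Hf i).
by move=> i _; case: (Hf i).
Qed.

Lemma bowen_ball_sym n e x y : bowen_ball T n x e y -> bowen_ball T n y e x.
Proof. by move=> xy i /xy; rewrite metric_sym. Qed.

Lemma bowen_ball_open n x e : continuous T -> open (bowen_ball T n x e).
Proof.
move=> contT.
have -> : bowen_ball T n x e =
    \bigcap_(i < n) (iter i T @^-1` [set y | mdist (iter i T x) y < e]).
  by apply/seteqP; split => y xy i; exact: xy.
rewrite bigcap_mkord; elim/big_ind: _ => [|A B|i _]; first exact: openT.
  exact: openI.
apply: open_comp; last exact: metric_ball_open.
move=> y _; elim: (i : nat) => [|k IHk] /=; first exact: cvg_id.
by apply: continuous_comp => //; exact: contT.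
Qed.

Lemma open_borel (A : set X) : open A -> measurable (A : set (borelType X)).
Proof. by move=> oA; apply: sub_gen_smallest. Qed.

(** Compactness extracts finitely many balls of radius [e / 2]. Such covers serve both to bound
    separated sums and to bound the number of greedy steps. *)
Lemma open_cover_mesh e : compact [set: X] -> 0 < e ->
  exists2 U, open_cover (X := X) U &
    forall V, U V -> forall x y, V x -> V y -> mdist x y < e.
Proof.
move=> compactX e0.
pose b (x : X) := [set y | mdist x y < e / 2].
have ob x : open (b x) by exact: metric_ball_open.
have := compactX; rewrite compact_cover => /(_ X setT b (fun x _ => ob x)).
case=> [x _|D _ XD].
  by exists x => //; rewrite /b /= mdistxx divr_gt0.
exists (b @` [set` D]).
  split=> [|_ [x _ <-]//]; split.
  - by apply: finite_image; exact: finite_fset.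
  - by move=> _ [x _ <-]; exact: open_borel.
  - rewrite -subTset => x /XD[y Dy yx].
    by exists (b y) => //; exists y.
move=> _ [z _ <-] x y zx zy; apply: (le_lt_trans (metric_triangle _ z _)).
by rewrite (splitr e) ltrD// metric_sym.
Qed.

(** * Comparison of separated sums and cover sums at a fixed time *)

Lemma weight_gt0 n x : (0 < weight T E n x)%E.
Proof. by rewrite lte_fin expR_gt0. Qed.

Lemma sup_weight_ge0 n V : (0 <= sup_weight T E n V)%E.
Proof. by rewrite le_max lexx. Qed.

Lemma separated_sum_ge0 e n : (0 <= separated_sum T E e n)%E.
Proof.
apply: ereal_sup_ubound; exists set0; last exact: esum_set0.
by move=> x y.
Qed.

Lemma cover_sum_ge0 U n : (0 <= cover_sum T E U n)%E.
Proof.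
apply: le_ereal_inf_tmp => _ [VV _ <-]; apply: fsume_ge0 => V _.
exact: sup_weight_ge0.
Qed.

Lemma le_separated_sum e e' n : e <= e' ->
  (separated_sum T E e' n <= separated_sum T E e n)%E.
Proof.
move=> ee'; apply: ereal_sup_le; apply: image_subset => S sepS x y Sx Sy xy xye.
by apply: (sepS x y) => // i /xye /lt_le_trans; apply.
Qed.

Lemma separated_sum_le_cover_sum (U : set (set X)) e n :
    (forall V, U V -> forall x y, V x -> V y -> mdist x y < e) ->
  (separated_sum T E e n <= cover_sum T E U n)%E.
Proof.
move=> meshU; apply: le_ereal_inf_tmp => _ [VV [[finVV _ covVV] finerVV] <-].
apply: ge_ereal_sup => _ [S sepS <-]; apply: ge_ereal_sup => _ [F [finF FS] <-].
have /choice[f Hf] x : exists V, VV V /\ V x.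
  have [V VVV Vx] : (\bigcup_(V in VV) V) x by rewrite covVV.
  by exists V.
(* Two points in one member of [VV] share an itinerary through [U], so they stay within [e] up to
   time [n] and separation makes them equal. *)
have injf : set_inj F f.
  move=> x y /set_mem Fx /set_mem Fy fxy; apply: contrapT => xy.
  apply: (sepS x y (FS _ Fx) (FS _ Fy) xy) => i ni.
  have [VVx fx] := Hf x; have [_ fy] := Hf y.
  have [A /iterated_coverP[g Ug ->] fA] := finerVV _ VVx.
  apply: (meshU _ (Ug i ni)); [exact: (fA _ fx)|].
  by rewrite -fxy in fy; exact: (fA _ fy).
apply: (@le_trans _ _ (\sum_(x \in F) sup_weight T E n (f x))%E).
  apply: lee_fsum => // x Fx; rewrite le_max; apply/orP; right.
  by apply: ereal_sup_ubound; exists x => //; case: (Hf x).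
(* By injectivity the sum runs over distinct members of [VV]; the other members contribute
   nonnegative terms. *)
rewrite -(fsbig_image _ _ (sup_weight T E n) injf); apply: lee_fsum_nneg_subset => //.
- exact: finite_image.
- by move=> _ /set_mem[x _ <-]; apply/mem_set; case: (Hf x).
- by move=> V _; exact: sup_weight_ge0.
Qed.

Lemma cover_sum_le_separated_sum (U : set (set X)) e n :
    compact [set: X] -> continuous T -> 0 < e ->
    (forall x, exists2 V, U V & [set y | mdist x y < e] `<=` V) ->
  (cover_sum T E U n <= separated_sum T E e n)%E.
Proof.
move=> compactX contT e0 lebU.
(* If the weights are unbounded, singletons, which are always separated, already make the separated
   sum infinite. *)
have [wy|wy] :=
  ltP (ereal_sup [set weight T E n x | x in [set: X]]) +oo%E; last first.
  rewrite (le_trans (leey _))// (le_trans wy)//.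
  apply: ge_ereal_sup => _ [x _ <-].
  apply: ereal_sup_ubound; exists [set x]; first by move=> a b -> ->.
  by rewrite esum_set1// ltW// weight_gt0.
apply/lee_mul01Pr; first exact: cover_sum_ge0.
move=> r r01.
have [W [[finW _ covW] _] meshW] := open_cover_mesh _ compactX e0.
have /finite_seqP[s Es] := iterated_cover_finite _ n finW.
have [|||||||S [VV [[_ finS sepS] [finVV covVV mVV VVB rVV]]]] :=
  @greedy_packing _ (borelType X) R (fun x => bowen_ball T n x e)
     (weight T E n) _ _ _ r s setT r01.
- by move=> x; apply: open_borel; exact: bowen_ball_open.
- by move=> x y; exact: bowen_ball_sym.
- exact: weight_gt0.
- exact: measurableT.
- move=> C sC x y Cx Cy i ni.
  have : iterated_cover T W n C by rewrite Es.
  move=> /iterated_coverP[f Wf Cf]; apply: (meshW _ (Wf i ni)).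
    by move: Cx; rewrite Cf => /(_ i ni).
  by move: Cy; rewrite Cf => /(_ i ni).
- by rewrite -Es bigcup_iterated_cover.
- exact: wy.
apply: (@le_trans _ _ (\sum_(x \in S) weight T E n x)%E); last first.
  apply: ereal_sup_ubound; exists S => //.
  by rewrite esum_fset// => x _; rewrite ltW// weight_gt0.
apply: le_trans rVV; rewrite lee_pmul2l ?lte_fin//; last by case/andP: r01.
apply: ereal_inf_lbound; exists VV => //; split; first by split.
move=> V /VVB[x Vx].
(* The Lebesgue property at each point of the orbit of [x] puts the whole Bowen ball inside one
   member of the iterated cover. *)
have /choice[f Hf] i : exists A,
    U A /\ [set y | mdist (iter i T x) y < e] `<=` A.
  by have [A UA xA] := lebU (iter i T x); exists A.
exists (\bigcap_(i < n) (iter i T @^-1` f i)).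
  by apply/iterated_coverP; exists f => // i _; case: (Hf i).
by move=> y /Vx xy i ni; case: (Hf i) => _; apply; exact: xy.
Qed.

(** * Passage to the limit in time and scale *)

(* [L] stands for [limn_esup] or [limn_einf]. *)
Lemma pressure_variation (L : (nat -> \bar R) -> \bar R) :
    (forall u v : nat -> \bar R, (forall n, u n <= v n)%E -> (L u <= L v)%E) ->
    compact [set: X] -> continuous T ->
  lim (L (fun n => (n%:R^-1)%:E * lne (separated_sum T E e n))%E
         @[e --> 0^'+]) =
  ereal_sup [set L (fun n => (n%:R^-1)%:E * lne (cover_sum T E U n))%E |
             U in open_cover (X := X)].
Proof.
move=> monoL compactX contT.
(* Nonnegativity of [u] passes to [v], so both stay where [lne] is monotone. *)
have monoS (u v : nat -> \bar R) :
    (forall n, 0 <= u n)%E -> (forall n, u n <= v n)%E ->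
    (L (fun n => (n%:R^-1)%:E * lne (u n)) <=
     L (fun n => (n%:R^-1)%:E * lne (v n)))%E.
  move=> u0 uv; apply: monoL => n; apply: lee_wpmul2l.
    by rewrite lee_fin invr_ge0.
  by rewrite lee_lne// in_itv /= ?leey ?u0//= (le_trans (u0 n)).
set g := (fun e => L (fun n => (n%:R^-1)%:E * lne (separated_sum T E e n)))%E.
have gmono e e' : e <= e' -> (g e' <= g e)%E.
  move=> ee'; apply: monoS => n; first exact: separated_sum_ge0.
  exact: le_separated_sum.
(* As [g] is nonincreasing, its limit at 0 from the right exists and is a supremum over positive
   [e]; two suprema remain to be compared. *)
have g01 : g e @[e --> 0^'+] --> ereal_sup [set g e | e in `]0, +oo[].
  by apply: nonincreasing_at_right_cvge => // a b _ _; exact: gmono.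
rewrite (cvg_lim _ g01)//; apply/eqP; rewrite eq_le; apply/andP; split.
  apply: ge_ereal_sup => _ [e /= + <-]; rewrite in_itv /= andbT => e0.
  have [U oU meshU] := open_cover_mesh _ compactX e0.
  apply: le_ereal_sup_tmp; eexists; first by exists U.
  apply: monoS => n; first exact: separated_sum_ge0.
  exact: separated_sum_le_cover_sum.
apply: ge_ereal_sup => _ [U [[_ _ covU] oU] <-].
have [e [e0 Ue]] : exists e, 0 < e /\
    forall x, exists2 V, U V & [set y | mdist x y < e] `<=` V.
  have [e] := @filter_ex _ (0^'+) _ _ (filterI (nbhs_right_gt (0 : R))
    (lebesgue_number _ compactX oU covU)).
  by exists e.
apply: le_ereal_sup_tmp; exists (g e).
  by exists e => //=; rewrite in_itv /= e0.
apply: monoS => n; first exact: cover_sum_ge0.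
exact: cover_sum_le_separated_sum.
Qed.

End pressure.

Theorem theorem1p4 (R : realType) (X : pmetricType R) (T : X -> X)
    (E : borel_probability X -> R)
    (compactX : compact [set: X]) (contT : continuous T)
    (surjT : range T = [set: X]) (energyE : energy E) :
  pressure T E = ereal_sup [set local_pressure T E U | U in open_cover (X := X)] /\
  lower_pressure T E =
    ereal_sup [set local_lower_pressure T E U | U in open_cover (X := X)].
Proof.
split; apply: pressure_variation => //.
  exact: le_limn_esup.
exact: le_limn_einf.
Qed.
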